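(* Let $R$ be a semi-local ring (i.e., $R/J(R)$ is semisimple Artinian), where $J(R)$ denotes the Jacobson radical. Then the following are equivalent: (i) $R$ is a GSWNC ring; (ii) one of the following holds: $R$ is a local ring and $J(R)$ is nil; or $J(R)$ is nil and $R/J(R) \cong {\rm M}_2(\mathbb{Z}_3)$; or $J(R)$ is nil and $R/J(R) \cong {\rm M}_2(\mathbb{Z}_2)$; or $J(R)$ is nil and $R/J(R) \cong \mathbb{Z}_3 \times \mathbb{Z}_3$; or $R$ is a strongly weakly nil-clean ring.
   Context: All rings are associative with identity. An element $a$ of a ring $S$ is called strongly weakly nil-clean if there exist an idempotent $e \in S$ and a nilpotent $q \in S$ with $eq = qe$ such that $a = q + e$ or $a = q - e$. A ring is strongly weakly nil-clean if all its elements are strongly weakly nil-clean. A ring $S$ is called GSWNC if every non-invertible element of $S$ is strongly weakly nil-clean. *)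

(* Defs.v *)
From HB Require Import structures.
From mathcomp Require Import all_boot all_order all_algebra.
Set Implicit Arguments. Unset Strict Implicit. Unset Printing Implicit Defensive.
Import GRing.Theory.
Local Open Scope ring_scope.

Definition nilp {R : nzRingType} (x : R) : Prop := exists n : nat, x ^+ n = 0.

Definition swnc_elt {R : nzRingType} (a : R) : Prop :=
  exists e q : R, e * e = e /\ nilp q /\ e * q = q * e /\ (a = q + e \/ a = q - e).

Definition swnc_ring (R : nzRingType) : Prop := forall a : R, swnc_elt a.

Definition GSWNC (R : unitRingType) : Prop :=
  forall a : R, a \isn't a GRing.unit -> swnc_elt a.

Definition left_ideal {R : nzRingType} (I : R -> Prop) : Prop :=
  I 0 /\ (forall x y, I x -> I y -> I (x + y)) /\ (forall r x, I x -> I (r * x)).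

Definition proper {R : nzRingType} (I : R -> Prop) : Prop := ~ I 1.

Definition max_left_ideal {R : nzRingType} (I : R -> Prop) : Prop :=
  left_ideal I /\ proper I /\
  (forall K : R -> Prop, left_ideal K -> proper K -> (forall x, I x -> K x) ->
     forall x, K x -> I x).

Definition jacobson {R : nzRingType} (x : R) : Prop :=
  forall I : R -> Prop, max_left_ideal I -> I x.

Definition J_nil (R : nzRingType) : Prop := forall x : R, jacobson x -> nilp x.

Definition local_ring (R : nzRingType) : Prop :=
  exists M : R -> Prop, max_left_ideal M /\
    forall N : R -> Prop, max_left_ideal N -> forall x, N x <-> M x.

Definition left_artinian (S : nzRingType) : Prop :=
  forall I : nat -> S -> Prop, (forall n, left_ideal (I n)) ->
    (forall n x, I n.+1 x -> I n x) ->
    exists N, forall n, (N <= n)%N -> forall x, I n x <-> I N x.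

Definition left_semisimple (S : nzRingType) : Prop :=
  forall I : S -> Prop, left_ideal I ->
    exists K : S -> Prop, left_ideal K /\ (forall x, I x -> K x -> x = 0) /\
      (forall z, exists x y, I x /\ K y /\ z = x + y).

Definition semisimple_artinian (S : nzRingType) : Prop :=
  left_artinian S /\ left_semisimple S.

(* R/J(R) is isomorphic to S: there is a surjective unital ring homomorphism
   R -> S whose kernel is exactly J(R) (first isomorphism theorem). *)
Definition quot_J_iso (R S : nzRingType) : Prop :=
  exists f : R -> S,
    (forall x y, f (x + y) = f x + f y) /\
    (forall x y, f (x * y) = f x * f y) /\ f 1 = 1 /\
    (forall s, exists x, f x = s) /\
    (forall x, f x = 0 <-> jacobson x).

Definition semilocal (R : nzRingType) : Prop :=
  exists (S : nzRingType), quot_J_iso R S /\ semisimple_artinian S.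

(* Main.v *)
(** An element [a] is strongly weakly nil-clean iff [a ^+ 2 - a] or [a ^+ 2 + a] is
    nilpotent: idempotents lift inside the commutative subring generated by [a].
    Once [J(R)] is nil this condition, like invertibility, can be tested in
    [S = R / J(R)], which settles the converse.

    For the direct implication no Wedderburn-Artin decomposition is needed: of the
    semisimple ring [S] only von Neumann regularity is used.  If [S] is not reduced,
    [x ^+ 2 = 0] with [x != 0] extends to a system of 2 x 2 matrix units.  It must sum
    to 1, since otherwise the matrix [[1, 1], [1, 0]] of the corner is a non-unit of
    [S] violating the condition; and the corner ring at the first diagonal idempotent
    [e] can only be [{0, e, -e}], which leaves M_2(Z_2) and M_2(Z_3).  If [S] is reduced,
    every non-unit is plus or minus a central idempotent, and a unit [u <> 1, -1] must be
    [e - (1 - e)] for such an idempotent, both corners being Z_3. *)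

From mathcomp Require Import all_boot all_order all_algebra.
From mathcomp Require boolp classical_sets.
From Stdlib Require Ncring Ncring_tac.
Require Import Defs.
Set Implicit Arguments. Unset Strict Implicit. Unset Printing Implicit Defensive.
Import GRing.Theory.
Local Open Scope ring_scope.

(** These instances let the normaliser of noncommutative polynomial identities act on any
    [nzRingType], as the tactic [ncring]. *)
Local Instance nz_ring_ops (S : nzRingType) :
  @Ncring.Ring_ops S 0 1 +%R *%R (fun x y => x - y) -%R eq := {}.
Local Instance nz_ring (S : nzRingType) : Ncring.Ring (Ro := nz_ring_ops S).
Proof.
split; rewrite ?/(Algebra_syntax.equality) /Ncring.eq_notation.
- exact: RelationClasses.eq_equivalence.
1-4: by move=> ? ? -> // ? ? ->.
- exact: add0r.
- exact: addrC.
- exact: addrA.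
- exact: mul1r.
- exact: mulr1.
- exact: mulrA.
- exact: mulrDl.
- by move=> x y z; exact: mulrDr.
- by [].
- exact: subrr.
Qed.

Ltac ncring := Ncring_tac.non_commutative_ring.

(** * Nilpotents and lifting of idempotents *)

Lemma nilpN (S : nzRingType) (x : S) : nilp x -> nilp (- x).
Proof. by case=> n xn0; exists n; rewrite exprNn xn0 mulr0. Qed.

Lemma nilpM_comm (S : nzRingType) (x y : S) :
  GRing.comm x y -> nilp x -> nilp (x * y).
Proof. by move=> cxy [n xn0]; exists n; rewrite exprMn_comm // xn0 mul0r. Qed.

Lemma nilpD_comm (S : nzRingType) (x y : S) :
  GRing.comm x y -> nilp x -> nilp y -> nilp (x + y).
Proof.
move=> cxy [m xm0] [n yn0]; exists (m + n)%N.
rewrite exprDn_comm // big1 // => i _.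
have [le_ni | lt_in] := leqP n i.
  by rewrite -(subnK le_ni) exprD yn0 !mulr0 mul0rn.
by rewrite -addnBA ?(ltnW lt_in) // exprD xm0 !mul0r mul0rn.
Qed.

(** Since [c] commutes with [j], [(c * j) ^+ n = c ^+ n * j ^+ n], and [b ^+ n] is a left inverse of
    [c ^+ n]. *)
Lemma nilp_mulrI (S : nzRingType) (b c j : S) :
  b * c = 1 -> GRing.comm c j -> nilp (c * j) -> nilp j.
Proof.
move=> bc1 ccj [n]; rewrite exprMn_comm // => cjn0; exists n.
have bcn k : b ^+ k * c ^+ k = 1.
  elim: k => [|k IHk]; first by rewrite !expr0 mulr1.
  by rewrite exprSr exprS mulrA -(mulrA _ b) bc1 mulr1.
by rewrite -[_ ^+ _]mul1r -(bcn n) -mulrA cjn0 mulr0.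
Qed.

Lemma nilp_unipotent_inv (S : nzRingType) (x : S) :
  nilp x -> exists y, y * (1 - x) = 1 /\ (1 - x) * y = 1.
Proof.
case=> n xn0; exists (\sum_(i < n) x ^+ i).
have h : (1 - x) * \sum_(i < n) x ^+ i = 1.
  rewrite -[RHS]subr0 -[in RHS]xn0 -{2}(expr1n _ n) subrXX_comm;
    last exact: commr_sym (commr1 _).
  by congr (_ * _); apply: eq_bigr => i _; rewrite expr1n mul1r.
split=> //; rewrite -[RHS]h; apply: commr_sym; apply: commr_sum => i _.
apply: commrX; apply: commr_sym; apply: commrB; [exact: commr1 | exact: commr_refl].
Qed.

Lemma idem_expr (S : nzRingType) (e : S) n : e * e = e -> e ^+ n.+1 = e.
Proof. by move=> ee; elim: n => [|n IHn]; rewrite ?expr1 // exprS IHn. Qed.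

Lemma nilp_idem (S : nzRingType) (e : S) : e * e = e -> nilp e -> e = 0.
Proof.
move=> ee [[|n]]; last by rewrite idem_expr.
by move/eqP; rewrite expr0 oner_eq0.
Qed.

(* With [e := 1 - (1 - a ^+ n) ^+ n], [e] is a multiple of [a ^+ n] and [1 - e]
   one of [(1 - a) ^+ n], so that [e * (1 - e)] vanishes with [(a * (1 - a)) ^+ n]. *)
Lemma idem_lift (S : nzRingType) (a : S) : nilp (a ^+ 2 - a) ->
  exists e, e * e = e /\ nilp (a - e) /\ e * a = a * e.
Proof.
case=> n d0.
pose b := 1 - a.
have cab : GRing.comm a b by apply: commrB; [exact: commr1 | exact: commr_refl].
have abn0 : a ^+ n * b ^+ n = 0.
  by rewrite -exprMn_comm // /b mulrBr mulr1 -opprB exprNn -expr2 d0 mulr0.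
pose e := 1 - (1 - a ^+ n) ^+ n.
have [g eE] : exists g, e = a ^+ n * g.
  exists (\sum_(i < n) 1 ^+ (n.-1 - i) * (1 - a ^+ n) ^+ i).
  rewrite /e -{1}(expr1n _ n) subrXX_comm; last exact: commr_sym (commr1 _).
  by rewrite opprB addrC subrK.
have [h fE] : exists h, 1 - e = b ^+ n * h.
  pose h0 := \sum_(i < n) 1 ^+ (n.-1 - i) * a ^+ i.
  have cah0 : GRing.comm a h0.
    apply: commr_sum => i _; rewrite expr1n mul1r.
    by apply: commrX; exact: commr_refl.
  exists (h0 ^+ n).
  rewrite /e opprB addrC subrK -{1}(expr1n _ n) subrXX_comm; last exact: commr_sym (commr1 _).
  rewrite exprMn_comm //; apply: commr_sym; apply: commrB; first exact: commr1.
  exact: commr_sym.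
have cae : GRing.comm a e.
  apply: commrB (commr1 _) _; apply: commrX; apply: commrB (commr1 _) _.
  exact: commrX.
have ce x : GRing.comm x a -> GRing.comm x e.
  move=> cx; apply: commrB; first exact: commr1.
  by apply: commrX; apply: commrB; [exact: commr1 | exact: commrX].
clearbody e.
have cbe : GRing.comm b e by apply: ce; apply: commr_sym.
have ebn0 : e * b ^+ n = 0.
  have cb : GRing.comm (b ^+ n) (a ^+ n).
    by apply: commrX; apply: commr_sym; apply: commrX.
  rewrite (commrX n (commr_sym cbe)) eE mulrA cb.
  by rewrite abn0 mul0r.
have ef0 : e * (1 - e) = 0 by rewrite fE mulrA ebn0 mul0r.
have ee : e * e = e.
  by apply/eqP; rewrite eq_sym -subr_eq0 -{1}[e]mulr1 -mulrBr ef0.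
have fan0 : (1 - e) * a ^+ n = 0.
  have cf : GRing.comm (1 - e) (a ^+ n).
    apply: commrX; apply: commr_sym; apply: commrB => //; exact: commr1.
  rewrite cf fE mulrA abn0 mul0r //.
exists e; split=> //; split; last by rewrite cae.
have fnf : (1 - e) * (1 - e) = 1 - e by rewrite mulrBl mul1r ef0 subr0.
(* Both terms are nilpotent, because [1 - e] kills [a ^+ n] and [e] kills [b ^+ n]; and they
   commute. *)
have -> : a - e = (1 - e) * a - e * b.
  by rewrite /b mulrBl mul1r mulrBr mulr1 opprB addrA subrK.
have cfa : GRing.comm (1 - e) a.
  apply: commr_sym; apply: commrB => //; exact: commr1.
apply: nilpD_comm.
- apply: commrN; apply: commrM; apply: commr_sym; apply: commrM.
  + apply: commrB; [exact: commr1 | exact: commr_refl].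
  + exact: commr_sym.
  + apply: commrB; first exact: commr1. exact: cbe.
  + exact: commr_sym.
- exists n.+1; rewrite exprMn_comm // idem_expr // exprSr mulrA fan0 mul0r //.
- apply: nilpN; exists n.+1; rewrite exprMn_comm; last exact: commr_sym.
  by rewrite idem_expr // exprSr mulrA ebn0 mul0r.
Qed.

(** A polynomial form of the condition, without [e] and [q], so that it passes through ring
    morphisms in both directions when the kernel is nil. *)
Definition pm_idem_mod_nil (S : nzRingType) (a : S) : Prop :=
  nilp (a ^+ 2 - a) \/ nilp (a ^+ 2 + a).

(** For [a = q + e], [a ^+ 2 - a] is [q] times an element commuting with [q]. Conversely an
    idempotent is lifted from [a] or from [- a]. *)
Lemma swnc_eltP (S : nzRingType) (a : S) : swnc_elt a <-> pm_idem_mod_nil a.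
Proof.
split=> [[e [q [ee [nq [ceq aE]]]]]|].
  have cq : GRing.comm q (e + e - 1).
    by apply: commrB (commr1 _); apply: commrD; symmetry.
  case: aE => ->; [left | right].
    suff -> : (q + e) ^+ 2 - (q + e) = q * (q + (e + e - 1)).
      by apply: nilpM_comm => //; exact: commrD.
    transitivity (q * (q + (e + e - 1)) + (e * q - q * e) + (e * e - e)).
      by rewrite expr2; ncring.
    by rewrite ceq ee !subrr !addr0.
  suff -> : (q - e) ^+ 2 + (q - e) = q * (q - (e + e - 1)).
    by apply: nilpM_comm => //; exact: commrB.
  transitivity (q * (q - (e + e - 1)) - (e * q - q * e) + (e * e - e)).
    by rewrite expr2; ncring.
  by rewrite ceq ee !subrr oppr0 !addr0.
case=> [/idem_lift [e [ee [na ce]]]|na].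
  exists e, (a - e); do !split=> //; first by rewrite mulrBr mulrBl ce.
  by left; rewrite subrK.
have /idem_lift[e [ee [na' ce]]] : nilp ((- a) ^+ 2 - - a) by rewrite sqrrN opprK.
exists e, (a + e); do !split=> //.
- by rewrite -[a + e]opprK opprD; apply: nilpN.
- by move: ce; rewrite mulrDr mulrDl mulrN mulNr => /oppr_inj ->.
- by right; rewrite addrK.
Qed.

(** * Von Neumann regularity and systems of matrix units *)

Definition invertible (S : nzRingType) (a : S) : Prop :=
  exists b, a * b = 1 /\ b * a = 1.

Definition nonunits_pm_idem (S : nzRingType) : Prop :=
  forall a : S, ~ invertible a -> pm_idem_mod_nil a.

Definition reduced (S : nzRingType) : Prop := forall x : S, x * x = 0 -> x = 0.

(** The map goes from the concrete ring [T] to [S], the direction in which matrix units or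
    idempotents give an explicit formula. *)
Definition iso_rings (S T : nzRingType) : Prop :=
  exists g : T -> S,
    (forall x y, g (x + y) = g x + g y) /\
    (forall x y, g (x * y) = g x * g y) /\ g 1 = 1 /\
    (forall t, g t = 0 -> t = 0) /\ (forall s, exists t, g t = s).

(** Applied to idempotents [h <> 1]: elements of a proper corner are non-units, so the hypothesis on
    non-units applies to them. *)
Lemma mulK_not_invertible (S : nzRingType) (h a : S) :
  h * a = a -> h <> 1 -> ~ invertible a.
Proof.
by move=> ha h1 [b [ab1 _]]; apply: h1; rewrite -[h]mulr1 -ab1 mulrA ha.
Qed.

(** A complement [K] of [S a] gives [1 = b * a + k] with [k] in [K]. Then [a * k = a - a * b * a]
    lies in both ideals, hence vanishes. *)
Lemma left_semisimple_regular (S : nzRingType) : left_semisimple S ->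
  forall a : S, exists b, a * b * a = a.
Proof.
move=> ss a; pose I x := exists r, x = r * a.
have I_ideal : left_ideal I.
  split; first by exists 0; rewrite mul0r.
  split=> [_ _ [r ->] [s ->]|r _ [s ->]]; first by exists (r + s); rewrite mulrDl.
  by exists (r * s); rewrite mulrA.
have [K [[K0 [KD KM]] [IK0 /(_ 1) [e [k [[b eE] [Kk e1k]]]]]]] := ss I I_ideal.
have ak0 : a * k = 0.
  apply: IK0; last exact: KM.
  have -> : a * k = (1 - a * b) * a by rewrite -[k](addKr e) -e1k eE; ncring.
  by exists (1 - a * b).
by exists b; rewrite -mulrA -eE -[RHS]mulr1 e1k mulrDr ak0 addr0.
Qed.

(** * Scalars from Z/(p+2) and recognition of matrix rings *)

Section NatScalars.

Variables (p : nat) (S : nzRingType).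
Hypothesis p0 : p.+2%:R = 0 :> S.

Definition zp_scalar (k : 'Z_p.+2) : S := (k : nat)%:R.

Lemma natr_modp0 n : (n %% p.+2)%:R = n%:R :> S.
Proof. by rewrite [in RHS](divn_eq n p.+2) natrD natrM p0 mulr0 add0r. Qed.

Lemma zp_scalarD k l : zp_scalar (k + l) = zp_scalar k + zp_scalar l.
Proof. by rewrite /zp_scalar -natrD -[RHS]natr_modp0. Qed.

Lemma zp_scalarM k l : zp_scalar (k * l) = zp_scalar k * zp_scalar l.
Proof. by rewrite /zp_scalar -natrM -[RHS]natr_modp0. Qed.

Lemma zp_scalar0 : zp_scalar 0 = 0. Proof. by []. Qed.

Lemma zp_scalar1 : zp_scalar 1 = 1. Proof. by []. Qed.

Lemma zp_scalarC k s : zp_scalar k * s = s * zp_scalar k.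
Proof. by rewrite /zp_scalar mulr_natl mulr_natr. Qed.

Lemma zp_scalar_pm k : k = 0 \/ k * k = 1 ->
  forall e : S, e <> 0 -> zp_scalar k * e = 0 -> k = 0.
Proof.
case=> // kk1 e e0 ke0; case: e0.
by rewrite -[e]mul1r -zp_scalar1 -kk1 zp_scalarM -mulrA ke0 mulr0.
Qed.

Lemma zp_scalar_pm_surj (e d : S) : d = 0 \/ d = e \/ d = - e ->
  exists k, d = zp_scalar k * e.
Proof.
case=> [|[]] ->; [exists 0 | exists 1 | exists (-1)].
- by rewrite zp_scalar0 mul0r.
- by rewrite zp_scalar1 mul1r.
- rewrite -[- e]mulN1r; congr (_ * e); apply/eqP; rewrite eq_sym -subr_eq0 opprK.
  by rewrite -zp_scalar1 -zp_scalarD addrC subrr.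
Qed.

(** Multiplying by [E 0 i] on the left and [E j 0] on the right moves the entry at [(i, j)] into the
    corner at [E 0 0], where the last two hypotheses identify it with a unique scalar. *)
Lemma matrix_units_iso n (E : 'I_n.+1 -> 'I_n.+1 -> S) :
  (forall i j k l, E i j * E k l = if j == k then E i l else 0) ->
  \sum_i E i i = 1 ->
  (forall k, zp_scalar k * E 0 0 = 0 -> k = 0) ->
  (forall s, exists k, E 0 0 * s * E 0 0 = zp_scalar k * E 0 0) ->
  iso_rings S 'M['Z_p.+2]_n.+1.
Proof.
move=> EM E1 E_inj E_surj.
exists (fun A : 'M['Z_p.+2]_n.+1 => \sum_i \sum_j zp_scalar (A i j) * E i j); split.
  move=> A B; rewrite -big_split; apply: eq_bigr => i _ /=.
  by rewrite -big_split; apply: eq_bigr => j _; rewrite mxE zp_scalarD mulrDl.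
split.
  move=> A B; rewrite mulr_suml; apply: eq_bigr => i _ /=.
  rewrite mulr_suml.
  transitivity (\sum_l \sum_j zp_scalar (A i j * B j l) * E i l).
    apply: eq_bigr => l _; rewrite mxE -mulr_suml; congr (_ * _).
    by apply: (big_morph zp_scalar zp_scalarD zp_scalar0).
  rewrite exchange_big; apply: eq_bigr => j _ /=.
  rewrite mulr_sumr [RHS](bigD1 j) //= [X in _ + X]big1 => [|k /negPf kj]; last first.
    rewrite mulr_sumr big1 // => l _.
    by rewrite -mulrA (mulrA (E i j)) -zp_scalarC -mulrA EM eq_sym kj !mulr0.
  rewrite addr0 mulr_sumr; apply: eq_bigr => l _.
  by rewrite -mulrA (mulrA (E i j)) -zp_scalarC -mulrA EM eqxx zp_scalarM mulrA.
split.
  rewrite -E1; apply: eq_bigr => i _; rewrite (bigD1 i) //= big1 => [|j /negPf ij].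
    by rewrite -idmxE mxE eqxx zp_scalar1 mul1r addr0.
  by rewrite -idmxE mxE eq_sym ij zp_scalar0 mul0r.
split.
  move=> A A0; apply/matrixP=> i j; rewrite [RHS]mxE; apply: E_inj.
  have := congr1 (fun x => E 0 i * x * E j 0) A0; rewrite /= mulr0 mul0r => <-.
  rewrite mulr_sumr mulr_suml (bigD1 i) //= [X in _ + X]big1 => [|k /negPf ki].
    rewrite addr0 mulr_sumr mulr_suml (bigD1 j) //= big1 => [|l /negPf lj].
      by rewrite addr0 mulrA -zp_scalarC -!mulrA EM eqxx EM eqxx.
    by rewrite mulrA -zp_scalarC -!mulrA EM lj !mulr0.
  rewrite mulr_sumr mulr_suml big1 // => l _.
  by rewrite mulrA -zp_scalarC -(mulrA _ (E 0 i)) EM eq_sym ki mulr0 mul0r.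
move=> s.
have /fin_all_exists [A AE] i : exists a : {ffun 'I_n.+1 -> 'Z_p.+2},
    forall j, E 0 i * s * E j 0 = zp_scalar (a j) * E 0 0.
  have /fin_all_exists [a aE] j : exists k, E 0 i * s * E j 0 = zp_scalar k * E 0 0.
    have [k kE] := E_surj (E 0 i * s * E j 0).
    by exists k; rewrite -kE !mulrA EM eqxx -!mulrA EM eqxx.
  by exists (finfun a) => j; rewrite ffunE.
exists (\matrix_(i, j) A i j).
rewrite -[RHS]mul1r -E1 mulr_suml; apply: eq_bigr => i _.
rewrite -[RHS]mulr1 -[in RHS]E1 mulr_sumr; apply: eq_bigr => j _.
rewrite mxE.
have -> : E i j = E i 0 * E 0 0 * E 0 j by rewrite EM eqxx EM eqxx.
rewrite !mulrA zp_scalarC -(mulrA (E i 0)) -AE !mulrA EM eqxx -!mulrA EM eqxx.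
by rewrite !mulrA.
Qed.

End NatScalars.

Lemma Z2_cases (a : 'Z_2) : a = 0 \/ a = 1.
Proof. by case: a => [[|[|]]] // lt_a; [left | right]; apply: val_inj. Qed.

Lemma Z3_cases (a : 'Z_3) : [\/ a = 0, a = 1 | a = -1].
Proof.
by case: a => [[|[|[|]]]] // lt_a;
  [constructor 1 | constructor 2 | constructor 3]; apply: val_inj.
Qed.

Lemma Z2_pm (k : 'Z_2) : k = 0 \/ k * k = 1.
Proof. by case: (Z2_cases k) => ->; [left | right; rewrite mulr1]. Qed.

Lemma Z3_pm (k : 'Z_3) : k = 0 \/ k * k = 1.
Proof. by case: (Z3_cases k) => ->; [left | right | right]; rewrite ?mulrNN ?mulr1. Qed.

(** * Rings with a nonzero element of square zero *)

Section SquareZero.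

Variable S : nzRingType.
Hypothesis pmS : nonunits_pm_idem S.

(** [x] and [y] are the off-diagonal matrix units of a 2 x 2 system whose diagonal idempotents
    [x * y] and [y * x] need not sum to 1. *)
Definition sq0_pair (x y : S) : Prop :=
  [/\ x * x = 0, y * y = 0, x * y * x = x & y * x * y = y].

(** The quasi-inverse [y] may have nonzero square. Its compression [(1 - e) * y * e] squares to zero
    because [e * (1 - e) = 0], and still satisfies [x * z = e]. *)
Lemma sq0_pair_ex (x y : S) : x * x = 0 -> x * y * x = x -> exists z, sq0_pair x z.
Proof.
move=> xx0 xyx; have [e eE] : exists e, e = x * y by exists (x * y).
have xe0 : x * e = 0 by rewrite eE mulrA xx0 mul0r.
have ex : e * x = x by rewrite eE.
have ee : e * e = e by rewrite [in X in _ * X]eE mulrA ex.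
have xf : x * (1 - e) = x by rewrite mulrBr mulr1 xe0 subr0.
have ef : e * (1 - e) = 0 by rewrite mulrBr mulr1 ee subrr.
exists ((1 - e) * y * e).
have xz : x * ((1 - e) * y * e) = e by rewrite !mulrA xf -eE ee.
split=> //; last 2 first.
- by rewrite xz.
- by rewrite -(mulrA _ x) xz -(mulrA _ e) ee.
- by rewrite !mulrA -(mulrA _ e) ef mulr0 !mul0r.
Qed.

(* The corner at [h := x * y + y * x] is a 2 x 2 matrix ring, in which
   [a := [[1, 1], [1, 0]]] satisfies [a ^ 2 - a = h] and [a ^ 2 + a = a ^ 3], both
   invertible in the corner. *)
Lemma sq0_pair_sum1 (x y : S) : sq0_pair x y -> x <> 0 -> x * y + y * x = 1.
Proof.
move=> [xx0 yy0 xyx yxy] x0; set h := x * y + y * x.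
pose a := x * y + x + y.
have hx : h * x = x by rewrite /h mulrDl xyx -mulrA xx0 mulr0 addr0.
have hy : h * y = y by rewrite /h mulrDl yxy -mulrA yy0 mulr0 add0r.
have xh : x * h = x by rewrite /h mulrDr !mulrA xyx xx0 mul0r add0r.
have yh : y * h = y by rewrite /h mulrDr !mulrA yxy yy0 mul0r addr0.
have hh : h * h = h by rewrite {2}/h mulrDr !mulrA hx hy.
have ha : h * a = a by rewrite /a !mulrDr mulrA hx hy.
have ah : a * h = a by rewrite /a !mulrDl -mulrA xh yh.
have aa : a * a = a + h.
  rewrite /a !mulrDl !mulrDr !mulrA xyx yxy xx0 yy0 !mul0r -!mulrA yy0 !mulr0 !addr0 !add0r.
  by rewrite /h; ncring.
have h0 : h <> 0 by move=> h0; apply: x0; rewrite -hx h0 mul0r.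
clearbody a h.
have [// | h1] := boolp.EM (h = 1); case: h0.
case: (pmS (mulK_not_invertible ha h1)) => [|[n]].
  by rewrite expr2 aa addrAC subrr add0r => /nilp_idem ->.
have -> : a ^+ 2 + a = a ^+ 3 by rewrite (exprS a 2) !expr2 aa mulrDr ah aa.
rewrite -exprM => an0.
(* [a - h] is the inverse of [a] in the corner with identity [h], so no power of [a] vanishes. *)
have hE m : a ^+ m * (a - h) ^+ m * h = h.
  elim: m => [|m IHm]; first by rewrite !expr0 !mul1r.
  rewrite exprSr exprS mulrA -(mulrA (a ^+ m) a) mulrBr aa ah addrAC subrr add0r.
  have ch : GRing.comm h (a - h) by rewrite /GRing.comm mulrBl mulrBr ah ha.
  by rewrite -!mulrA -(commrX m ch) (mulrA h h) hh (commrX m ch) mulrA IHm.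
by rewrite -(hE (3 * n)%N) an0 !mul0r.
Qed.

Hypothesis regS : forall a : S, exists b, a * b * a = a.
Variables x y e : S.
Hypothesis xyP : sq0_pair x y.
Hypothesis x0 : x <> 0.
Hypothesis eE : e = x * y.

(** Membership in the corner ring [e S e], whose identity is [e]. *)
Definition corner (d : S) : Prop := e * d = d /\ d * e = d.

Let ee : e * e = e.
Proof. by have [_ _ xyx _] := xyP; rewrite eE mulrA -(mulrA x) mulrA xyx. Qed.

Let e0 : e <> 0.
Proof. by have [_ _ xyx _] := xyP; move=> e0; apply: x0; rewrite -xyx -eE e0 mul0r. Qed.

Let e1 : e <> 1.
Proof.
by have [xx0 _ xyx _] := xyP; move=> e1; apply: x0; rewrite -[x]mulr1 -e1 eE mulrA xx0 mul0r.
Qed.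

(** [g * x] and [y * g] form another such pair, so [g + y * g * x = 1]. Left multiplication by [e]
    removes the second term, as [e * y = 0]. *)
Lemma corner_idem (g : S) : corner g -> g * g = g -> g <> 0 -> g = e.
Proof.
have [xx0 yy0 xyx yxy] := xyP.
move=> [eg ge] gg g0.
have xg0 : x * g = 0 by rewrite -eg eE !mulrA xx0 !mul0r.
have gy0 : g * y = 0 by rewrite -ge eE -!mulrA yy0 !mulr0.
have gxyg : g * x * (y * g) = g by rewrite mulrA -(mulrA g x) -eE ge gg.
have gxP : sq0_pair (g * x) (y * g).
  split.
  - by rewrite mulrA -(mulrA g) xg0 mulr0 mul0r.
  - by rewrite mulrA -(mulrA y) gy0 mulr0 mul0r.
  - by rewrite gxyg mulrA gg.
  - by rewrite -(mulrA (y * g)) gxyg -mulrA gg.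
have gx0 : g * x <> 0 by move=> gx0; apply: g0; rewrite -gxyg gx0 mul0r.
have := sq0_pair_sum1 gxP gx0; rewrite gxyg => /(congr1 ( *%R e)).
rewrite mulr1 mulrDr eg => <-.
by rewrite eE !mulrA -(mulrA x) yy0 mulr0 !mul0r addr0.
Qed.

(** If [d * b * d = d], then [d * b * e] is a nonzero idempotent of the corner, hence equals [e]. *)
Lemma corner_rinv (d : S) : corner d -> d <> 0 -> exists b, d * b = e /\ corner b.
Proof.
move=> [ed de] d0; have [b dbd] := regS d.
have gE : d * b * e = e.
  apply: corner_idem.
  - by split; rewrite ?mulrA ?ed // -mulrA ee.
  - by rewrite !mulrA -(mulrA (d * b) e d) ed dbd.
  - by move=> g0; apply: d0; rewrite -dbd -{2}ed mulrA g0 mul0r.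
exists (e * b * e); split; first by rewrite !mulrA de.
by split; rewrite ?mulrA ?ee // -!mulrA ee.
Qed.

Lemma corner_integral (c d : S) : corner c -> corner d -> c * d = 0 -> c = 0 \/ d = 0.
Proof.
move=> [ec ce] Dd cd0; have [d0 | d0] := boolp.EM (d = 0); [by right | left].
by have [b [db _]] := corner_rinv Dd d0; rewrite -ce -db mulrA cd0 mul0r.
Qed.

Lemma corner_nilp (d : S) : corner d -> nilp d -> d = 0.
Proof.
move=> Dd [n]; elim: n => [|n IHn].
  by rewrite expr0 => /eqP; rewrite oner_eq0.
case: n IHn => [|n] IHn; first by rewrite expr1.
rewrite exprS => /corner_integral [] // ; have [ed de] := Dd.
by split; [rewrite exprS mulrA ed | rewrite exprSr -mulrA de].
Qed.

(** As a non-unit of [S], [d] makes [d * (d - e)] or [d * (d + e)] nilpotent, and the corner has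
    neither nonzero nilpotents nor zero divisors. *)
Lemma corner_pm (d : S) : corner d -> d = 0 \/ d = e \/ d = - e.
Proof.
move=> Dd; have [ed de] := Dd.
have De : corner e by [].
have DB : corner (d - e) by split; rewrite ?mulrBr ?mulrBl ?ed ?de ee.
have DD : corner (d + e) by split; rewrite ?mulrDr ?mulrDl ?ed ?de ee.
have DM c : corner c -> corner (d * c).
  by case=> ec ce; split; rewrite ?mulrA ?ed // -mulrA ce.
have eq2 : d ^+ 2 - d = d * (d - e) by rewrite mulrBr de expr2.
have eq2' : d ^+ 2 + d = d * (d + e) by rewrite mulrDr de expr2.
case: (pmS (mulK_not_invertible ed e1)).
  rewrite eq2 => /corner_nilp => /(_ (DM _ DB)) /corner_integral[] //; first by left.
  by move/eqP; rewrite subr_eq0 => /eqP; right; left.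
rewrite eq2' => /corner_nilp => /(_ (DM _ DD)) /corner_integral[] //; first by left.
by move/eqP; rewrite addr_eq0 => /eqP; right; right.
Qed.

(** The corner element [e + e] is [0] or [- e]. A relation [e *+ n = 0] extends to all of [S]
    because [1 = e + y * e * x]. *)
Lemma sq0_char : 2%:R = 0 :> S \/ 3%:R = 0 :> S.
Proof.
have [xx0 yy0 xyx yxy] := xyP.
have one : e + y * x = 1 by rewrite eE; exact: sq0_pair_sum1.
have lift_e n : e *+ n = 0 -> n%:R = 0 :> S.
  move=> en0; rewrite -one mulrnDl en0 add0r.
  have -> : y * x = y * (e * x) by rewrite eE !mulrA yxy.
  by rewrite -mulrnAr -mulrnAl en0 mul0r mulr0.
have : corner (e + e) by split; rewrite ?mulrDr ?mulrDl ee.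
case/corner_pm => [e2|[e2|e2]].
- by left; apply: lift_e; rewrite mulr2n.
- by case: e0; apply: (addrI e); rewrite addr0.
- by right; apply: lift_e; rewrite mulrSr mulr2n e2 addrC subrr.
Qed.

Lemma sq0_matrix_iso :
  iso_rings S 'M['Z_2]_2 \/ iso_rings S 'M['Z_3]_2.
Proof.
have [xx0 yy0 xyx yxy] := xyP.
pose E (i j : 'I_2) :=
  if i == 0 then if j == 0 then x * y else x else if j == 0 then y else y * x.
have EM i j k l : E i j * E k l = if j == k then E i l else 0.
  (* Indices in ['I_2] are also residues modulo 2, so [Z2_cases] enumerates them. *)
  case: (Z2_cases i) => ->; case: (Z2_cases j) => ->;
  case: (Z2_cases k) => ->; case: (Z2_cases l) => ->;
  by rewrite /E /= ?mulrA ?xyx ?yxy ?xx0 ?yy0 ?mul0r //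
             -?(mulrA x y) -?(mulrA y x) ?xx0 ?yy0 ?mulr0 ?mul0r.
have E1 : \sum_i E i i = 1.
  by rewrite !big_ord_recl big_ord0 addr0; exact: sq0_pair_sum1.
have E_corner s : corner (E 0 0 * s * E 0 0).
  by rewrite /E /= -eE; split; rewrite ?mulrA ?ee // -!mulrA ee.
case: sq0_char => p0; [left | right]; apply: (matrix_units_iso p0 EM E1).
- by move=> k; apply: (zp_scalar_pm p0 (Z2_pm k)); rewrite /E /= -eE.
- by move=> s; apply: zp_scalar_pm_surj => //; have := corner_pm (E_corner s);
     rewrite /E /= -eE.
- by move=> k; apply: (zp_scalar_pm p0 (Z3_pm k)); rewrite /E /= -eE.
- by move=> s; apply: zp_scalar_pm_surj => //; have := corner_pm (E_corner s);
     rewrite /E /= -eE.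
Qed.

End SquareZero.

(** * Reduced rings *)

Section Reduced.

Variable S : nzRingType.
Hypothesis redS : reduced S.
Hypothesis pmS : nonunits_pm_idem S.

Lemma reduced_nilp (x : S) : nilp x -> x = 0.
Proof.
case=> n; elim: n => [|n IHn].
  by rewrite expr0 => /eqP; rewrite oner_eq0.
case: n IHn => [|n] IHn; first by rewrite expr1.
move=> xn0; apply: IHn; apply: redS.
by rewrite -exprD addSn -addnS exprD xn0 mulr0.
Qed.

(** Both [e * s * (1 - e)] and [(1 - e) * s * e] have square zero. *)
Lemma reduced_idemC (e s : S) : e * e = e -> e * s = s * e.
Proof.
move=> ee; transitivity (e * s * e).
  have : e * s * (1 - e) * (e * s * (1 - e)) = 0.
    have -> : e * s * (1 - e) * (e * s * (1 - e)) =
              e * s * (e - e * e) * s * (1 - e) by ncring.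
    by rewrite ee subrr mulr0 !mul0r.
  by move/redS/eqP; rewrite mulrBr mulr1 subr_eq0 => /eqP.
have : (1 - e) * s * e * ((1 - e) * s * e) = 0.
  have -> : (1 - e) * s * e * ((1 - e) * s * e) =
            (1 - e) * s * (e - e * e) * s * e by ncring.
  by rewrite ee subrr mulr0 !mul0r.
by move/redS/eqP; rewrite mulrBl mul1r mulrBl subr_eq0 => /eqP.
Qed.

Lemma reduced_nonunit (a : S) : ~ invertible a -> a * a = a \/ a * a = - a.
Proof.
case/pmS=> /reduced_nilp /eqP; rewrite expr2 ?subr_eq0 ?addr_eq0 => /eqP; tauto.
Qed.

(** The non-unit [e * u] has square [e * u * u], equal to plus or minus [e * u]; one factor [u] is
    then cancelled. *)
Lemma reduced_idem_mul_unit (e u : S) : invertible u -> e * e = e -> e <> 1 ->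
  e * u = e \/ e * u = - e.
Proof.
move=> [v [uv1 _]] ee e1.
have /mulK_not_invertible/(_ e1)/reduced_nonunit : e * (e * u) = e * u.
  by rewrite mulrA ee.
have -> : e * u * (e * u) = e * u * u.
  by rewrite mulrA -(mulrA e u) -(reduced_idemC u ee) mulrA ee.
case=> /(congr1 ( *%R^~ v)); rewrite ?mulNr -!mulrA uv1 !mulr1; tauto.
Qed.

(* Were [g := e * s] idempotent with [g <> 0] and [g <> e], the idempotents
   [g + (1 - e)] and [1 - g] would both have to be multiplied by [u] up to sign,
   forcing [2 g = 0] and [2 (e - g) = 0], hence [2 e = 0]. *)
Lemma reduced_corner_pm (e u : S) : invertible u -> u <> 1 -> u <> - 1 ->
    e * e = e -> e * u = e -> (1 - e) * u = - (1 - e) ->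
  forall s, e * s = 0 \/ e * s = e \/ e * s = - e.
Proof.
move=> u_inv u1 uN1 ee eu fu s.
have uE : u = e - (1 - e) by rewrite -{1}eu -fu; ncring.
have e1 : e <> 1 by move=> e1; apply: u1; rewrite uE e1 subrr subr0.
have e2 : e + e <> 0.
  by move=> e2; apply: uN1; rewrite uE opprB addrA e2 sub0r.
have f2 : (1 - e) + (1 - e) <> 0.
  by move=> f2; apply: u1; rewrite uE -[RHS](subr0) -f2; ncring.
have idem_pm g : g * g = g -> e * g = g -> g = 0 \/ g = e.
  move=> gg eg; have ge : g * e = g by rewrite -(reduced_idemC g ee).
  have gu : g * u = g by rewrite -ge -mulrA eu.
  have [g0 | g0] := boolp.EM (g = 0); [by left | right].
  apply: boolp.contrapT => gNe.
  have k1 : g + (1 - e) <> 1.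
    move=> k1; apply: gNe; apply: (addIr (1 - e)); rewrite k1; ncring.
  have k1' : 1 - g <> 1.
    by move=> /(congr1 (fun x => 1 - x)); rewrite opprB addrCA subrr addr0.
  have kk : (g + (1 - e)) * (g + (1 - e)) = g + (1 - e).
    transitivity (g * g + (g - g * e) + (g - e * g) + (1 - e) + (e * e - e)); first by ncring.
    by rewrite gg ge eg ee !subrr !addr0.
  have kk' : (1 - g) * (1 - g) = 1 - g.
    transitivity (1 - g + (g * g - g)); first by ncring.
    by rewrite gg subrr addr0.
  (* The product with [u] is [g - (1 - e)]. The plus sign would make [(1 - e) + (1 - e)] vanish,
     against [f2]. *)
  have g2 : g + g = 0.
    case: (reduced_idem_mul_unit u_inv kk k1); rewrite mulrDl gu fu => h.
      case: f2; transitivity ((g + (1 - e)) - (g - (1 - e))); first by ncring.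
      by rewrite h subrr.
    transitivity ((g - (1 - e)) - (- (g + (1 - e)))); first by ncring.
    by rewrite h subrr.
  have h2 : (e - g) + (e - g) = 0.
    case: (reduced_idem_mul_unit u_inv kk' k1'); rewrite mulrBl mul1r gu uE => h.
      case: f2; transitivity ((1 - g) - (e - (1 - e) - g)); first by ncring.
      by rewrite h subrr.
    transitivity ((e - (1 - e) - g) - (- (1 - g))); first by ncring.
    by rewrite h subrr.
  apply: e2; transitivity (((e - g) + (e - g)) + (g + g)); first by ncring.
  by rewrite h2 g2 addr0.
have /mulK_not_invertible/(_ e1)/reduced_nonunit : e * (e * s) = e * s.
  by rewrite mulrA ee.
case=> ss.
  by case: (idem_pm _ ss) => [|->|->]; [rewrite mulrA ee | left | right; left].
case: (idem_pm (- (e * s))) => [|| /eqP | /eqP].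
- by rewrite mulrNN ss.
- by rewrite mulrN mulrA ee.
- by rewrite oppr_eq0 => /eqP; left.
- by rewrite eqr_oppLR => /eqP; right; right.
Qed.

Lemma reduced_Z3_square :
  (exists a : S, a <> 0 /\ ~ invertible a) ->
  ~ (forall a : S, pm_idem_mod_nil a) ->
  iso_rings S ('Z_3 * 'Z_3)%type.
Proof.
case=> a [a0 aNinv] /boolp.existsNP[u uN].
have u_inv : invertible u by apply: boolp.contrapT => /pmS.
have u1 : u <> 1.
  by move=> u1; apply: uN; left; exists 1%N; rewrite u1 expr1n subrr expr1.
have uN1 : u <> -1.
  by move=> uN1; apply: uN; right; exists 1%N; rewrite uN1 sqrrN expr1n subrr expr1.
have [e [ee e0 e1]] : exists e : S, [/\ e * e = e, e <> 0 & e <> 1].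
  case: (reduced_nonunit aNinv) => aa; [exists a | exists (- a)]; split=> //.
  - by move=> a1; apply: aNinv; exists 1; rewrite a1 mulr1.
  - by rewrite mulrNN.
  - by move/eqP; rewrite oppr_eq0 => /eqP.
  - move/eqP; rewrite eqr_oppLR => /eqP a1; apply: aNinv; exists (-1).
    by rewrite a1 mulrNN mulr1.
have ff : (1 - e) * (1 - e) = 1 - e.
  transitivity (1 - e + (e * e - e)); first by ncring.
  by rewrite ee subrr addr0.
have f0 : 1 - e <> 0 by move/eqP; rewrite subr_eq0 => /eqP /esym.
have f1 : 1 - e <> 1.
  by move=> /(congr1 (fun x => 1 - x)); rewrite opprB addrCA subrr addr0.
have uD : e * u + (1 - e) * u = u by ncring.
(* Equal signs on the two corners would make [u] equal to 1 or -1; opposite signs are ordered by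
   exchanging [e] and [1 - e]. *)
wlog [eu fu] : e ee e0 e1 ff f0 f1 uD / e * u = e /\ (1 - e) * u = - (1 - e).
  move=> base.
  have fE : 1 - (1 - e) = e by ncring.
  case: (reduced_idem_mul_unit u_inv ee e1) => eu.
    case: (reduced_idem_mul_unit u_inv ff f1) => fu; last exact: (base e).
    by case: u1; rewrite -uD eu fu; ncring.
  case: (reduced_idem_mul_unit u_inv ff f1) => fu.
    by apply: (base (1 - e)); rewrite ?fE // addrC.
  by case: uN1; rewrite -uD eu fu; ncring.
have e_pm := reduced_corner_pm u_inv u1 uN1 ee eu fu.
have uE : u = e - (1 - e) by rewrite -uD eu fu.
(* Replacing [u] by [- u] exchanges the roles of the two corners. *)
have f_pm s : (1 - e) * s = 0 \/ (1 - e) * s = 1 - e \/ (1 - e) * s = - (1 - e).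
  apply: (@reduced_corner_pm (1 - e) (- u)) => //.
  - by case: u_inv => v [uv vu]; exists (- v); rewrite !mulrNN.
  - by move/eqP; rewrite eqr_oppLR => /eqP.
  - by move/oppr_inj.
  - by rewrite mulrN fu opprK.
  - have -> : 1 - (1 - e) = e by ncring.
    by rewrite mulrN eu.
have three (g : S) : g + g <> 0 -> g <> 0 -> 
    g * (1 + 1) = 0 \/ g * (1 + 1) = g \/ g * (1 + 1) = - g -> g * 3%:R = 0.
  rewrite mulrDr mulr1 => g2 g0 [// | [|]].
    by move/eqP; rewrite -subr_eq0 addrK => /eqP.
  by move=> gN; rewrite mulr_natr mulrSr mulr2n gN addNr.
have e2 : e + e <> 0.
  by move=> e2; apply: uN1; rewrite uE opprB addrA e2 sub0r.
have f2 : (1 - e) + (1 - e) <> 0.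
  by move=> f2; apply: u1; rewrite uE -[RHS](subr0) -f2; ncring.
have p0 : 3%:R = 0 :> S.
  have -> : 3%:R = e * 3%:R + (1 - e) * 3%:R :> S by ncring.
  by rewrite (three e) // (three (1 - e)) // addr0.
have ef : e * (1 - e) = 0 by rewrite mulrBr mulr1 ee subrr.
have fe : (1 - e) * e = 0 by rewrite mulrBl mul1r ee subrr.
have zC := zp_scalarC (p := 1) (S := S).
exists (fun t : 'Z_3 * 'Z_3 => zp_scalar S t.1 * e + zp_scalar S t.2 * (1 - e)).
split; first by move=> s t; rewrite /= !zp_scalarD // !mulrDl addrACA.
split.
  move=> s t; rewrite /= !zp_scalarM // [RHS]mulrDl.
  rewrite (mulrDr (_ * e)) (mulrDr (_ * (1 - e))).
  have zz (c d : 'Z_3) (g h : S) :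
      zp_scalar S c * g * (zp_scalar S d * h) = zp_scalar S c * zp_scalar S d * (g * h).
    by rewrite !mulrA -(mulrA _ g) -zC mulrA.
  by rewrite !zz ee ff ef fe !mulr0 addr0 add0r.
split; first by rewrite /= zp_scalar1 !mul1r addrC subrK.
split.
  move=> [c d] /= cd0; congr pair.
    apply: (zp_scalar_pm p0 (Z3_pm c) e0).
    have := congr1 ( *%R^~ e) cd0.
    by rewrite /= mulrDl -!mulrA ee fe mulr0 addr0 mul0r.
  apply: (zp_scalar_pm p0 (Z3_pm d) f0).
  have := congr1 ( *%R^~ (1 - e)) cd0.
  by rewrite /= mulrDl -!mulrA ff ef mulr0 add0r mul0r.
move=> s.
have [c cE] := zp_scalar_pm_surj p0 (e_pm s).
have [d dE] := zp_scalar_pm_surj p0 (f_pm s).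
by exists (c, d); rewrite /= -cE -dE; ncring.
Qed.

End Reduced.

(** * The Jacobson radical and its quotient *)

(** Krull's theorem for left ideals, by Zorn's lemma. *)
Lemma max_left_ideal_ex (R : nzRingType) (I : R -> Prop) :
  left_ideal I -> proper I ->
  exists M, max_left_ideal M /\ forall x, I x -> M x.
Proof.
move=> I_ideal I1; have [I0 [ID IM]] := I_ideal.
(* [I] is joined to each member so that the empty chain has a bound. *)
pose P (A : R -> Prop) := left_ideal (fun x => I x \/ A x) /\ ~ A 1.
have [|A [[A_ideal A1] A_max]] := classical_sets.Zorn_bigcup (P := P).
  move=> F FP Ftot; split=> [|[X FX X1]]; last by case: (FP X FX).
  have FM X x : F X -> X x -> forall y, I y \/ X y ->
      I (x + y) \/ classical_sets.bigcup F id (x + y).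
    move=> FX Xx y Xy; have [[_ [XD _]] _] := FP X FX.
    by case: (XD x y (or_intror Xx) Xy); [left | right; exists X].
  split; first by left.
  split=> [x y|r x].
    case=> [Ix|[X FX Xx]] [Iy|[Y FY Yy]].
    - by left; exact: ID.
    - by rewrite addrC; apply: (FM Y) => //; left.
    - by apply: (FM X) => //; left.
    - case: (Ftot X Y FX FY) => sXY.
        by apply: (FM Y) => //; [exact: sXY | right].
      by apply: (FM X) => //; right; exact: sXY.
  case=> [Ix|[X FX Xx]]; first by left; exact: IM.
  have [[_ [_ XM]] _] := FP X FX.
  by case: (XM r x (or_intror Xx)); [left | right; exists X].
exists (fun x => I x \/ A x); split; last by left.
split=> //; split=> [[] // | K K_ideal K1 sMK x Kx].
apply: boolp.contrapT => nMx; apply: (A_max K).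
  by split=> [y Ay | sKA]; [apply: sMK; right | apply: nMx; right; exact: sKA].
have [K0 [KD KM]] := K_ideal.
have IK y : I y \/ K y -> K y by case=> // Iy; apply: sMK; left.
split=> //; split; first by left.
split=> [y z /IK Ky /IK Kz | r y /IK Ky]; right; [exact: KD | exact: KM].
Qed.

(** Otherwise the left ideal generated by [1 - j] lies in a maximal one, which also contains [j] and
    hence 1. *)
Lemma jacobson_one_sub (R : nzRingType) (j : R) :
  jacobson j -> exists b, b * (1 - j) = 1.
Proof.
move=> Jj; apply: boolp.contrapT => no_inv.
pose I x := exists r, x = r * (1 - j).
have I_ideal : left_ideal I.
  split; first by exists 0; rewrite mul0r.
  split=> [_ _ [r ->] [s ->]|r _ [s ->]]; first by exists (r + s); rewrite mulrDl.
  by exists (r * s); rewrite mulrA.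
have I_proper : proper I by case=> r r1; apply: no_inv; exists r.
have [M [M_max sIM]] := max_left_ideal_ex I_ideal I_proper.
have [[M0 [MD MM]] [M1 _]] := M_max.
apply: M1; rewrite -(subrK j 1); apply: MD; last exact: Jj.
by apply: sIM; exists 1; rewrite mul1r.
Qed.

Section Quotient.

Variables (R : unitRingType) (S : nzRingType) (f : R -> S).
Hypothesis fD : forall x y, f (x + y) = f x + f y.
Hypothesis fM : forall x y, f (x * y) = f x * f y.
Hypothesis f1 : f 1 = 1.
Hypothesis f_surj : forall s, exists x, f x = s.
Hypothesis f_ker : forall x, f x = 0 <-> jacobson x.

Lemma quot0 : f 0 = 0.
Proof. by apply: (addrI (f 0)); rewrite -fD !addr0. Qed.

Lemma quotN x : f (- x) = - f x.
Proof. by apply: (addrI (f x)); rewrite -fD !subrr quot0. Qed.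

Lemma quotB x y : f (x - y) = f x - f y.
Proof. by rewrite fD quotN. Qed.

Lemma quotX x n : f (x ^+ n) = f x ^+ n.
Proof. by elim: n => [|n IHn]; rewrite ?expr0 // !exprS fM IHn. Qed.

Lemma jacobson_not_unit (j : R) : jacobson j -> j \isn't a GRing.unit.
Proof.
move=> /f_ker fj0; apply/negP => /mulrV /(congr1 f).
by rewrite fM fj0 mul0r f1 => /eqP; rewrite eq_sym oner_eq0.
Qed.

Lemma jacobsonN (j : R) : jacobson j -> jacobson (- j).
Proof. by move=> /f_ker fj0; apply/f_ker; rewrite quotN fj0 oppr0. Qed.

(** The non-unit [j] has [(1 - j) * j] or [(1 + j) * j] nilpotent, and the first factor, left
    invertible, can be cancelled. *)
Lemma GSWNC_J_nil : GSWNC R -> J_nil R.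
Proof.
move=> gR j Jj.
have nilp_pm k : jacobson k -> nilp ((1 - k) * k) -> nilp k.
  move=> Jk; have [b bk] := jacobson_one_sub Jk; apply: nilp_mulrI bk _.
  by apply: commr_sym; apply: commrB; [exact: commr1 | exact: commr_refl].
have /gR/swnc_eltP [nj|nj] := jacobson_not_unit Jj.
  apply: nilp_pm => //; have -> : (1 - j) * j = - (j ^+ 2 - j) by rewrite expr2; ncring.
  exact: nilpN.
rewrite -[j]opprK; apply: nilpN; apply: nilp_pm; first exact: jacobsonN.
have -> : (1 - - j) * - j = - (j ^+ 2 + j) by rewrite expr2; ncring.
exact: nilpN.
Qed.

Lemma quot_pm_idem (a : R) : pm_idem_mod_nil a -> pm_idem_mod_nil (f a).
Proof.
by case=> -[n /(congr1 f)]; rewrite quotX quot0 ?quotB ?fD quotX => an0;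
  [left | right]; exists n.
Qed.

Lemma GSWNC_quot : GSWNC R -> nonunits_pm_idem S.
Proof.
move=> gR s; have [a <-] := f_surj s => fa_ninv.
apply/quot_pm_idem/swnc_eltP/gR/negP => a_unit; apply: fa_ninv.
by exists (f a^-1); rewrite -!fM mulrV ?mulVr.
Qed.

Hypothesis JR : J_nil R.

Lemma nilp_lift (a : R) : nilp (f a) -> nilp a.
Proof.
case=> n; rewrite -quotX => /f_ker /JR [m an0].
by exists (n * m)%N; rewrite exprM.
Qed.

Lemma pm_idem_lift (a : R) : pm_idem_mod_nil (f a) -> swnc_elt a.
Proof.
move=> na; apply/swnc_eltP.
by case: na => na; [left | right]; apply: nilp_lift; rewrite ?quotB ?fD quotX.
Qed.

(** For a preimage [b] of the inverse, [a * b] and [b * a] differ from 1 by nilpotents, so both are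
    invertible and [a] has an inverse on each side. *)
Lemma invertible_lift (a : R) : invertible (f a) -> a \is a GRing.unit.
Proof.
case=> s; have [b <-] := f_surj s; rewrite -!fM => -[ab ba].
have lift c : f c = 1 -> exists d, d * c = 1 /\ c * d = 1.
  move=> c1; have : nilp (1 - c) by apply: nilp_lift; rewrite quotB f1 c1 subrr; exists 1%N.
  by case/nilp_unipotent_inv => d; rewrite opprB addrC subrK; exists d.
have [d [_ abd]] := lift _ ab; have [d' [dba _]] := lift _ ba.
apply/unitrP; exists (b * d); split; last by rewrite mulrA.
have -> : b * d = d' * b by rewrite -[LHS]mul1r -dba -!mulrA (mulrA a) abd mulr1.
by rewrite -mulrA.
Qed.

Lemma quot_GSWNC : nonunits_pm_idem S -> GSWNC R.
Proof.
move=> pmS a /negP a_nunit; apply: pm_idem_lift; apply: pmS.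
by move=> /invertible_lift.
Qed.

Lemma quot_swnc : (forall s : S, pm_idem_mod_nil s) -> swnc_ring R.
Proof. by move=> pmS a; apply: pm_idem_lift. Qed.

End Quotient.

(** * Local rings as those with a division ring as quotient *)

Section LocalQuotient.

Variables (R S : nzRingType) (f : R -> S).
Hypothesis fD : forall x y, f (x + y) = f x + f y.
Hypothesis fM : forall x y, f (x * y) = f x * f y.
Hypothesis f1 : f 1 = 1.
Hypothesis f_surj : forall s, exists x, f x = s.
Hypothesis f_ker : forall x, f x = 0 <-> jacobson x.

Lemma jacobson_left_ideal : left_ideal (@jacobson R).
Proof.
split; first by move=> I [[]].
split=> [x y Jx Jy I I_max|r x Jx I I_max]; have [[_ [ID IM]] _] := I_max.
  by apply: ID; [exact: Jx | exact: Jy].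
by apply: IM; exact: Jx.
Qed.

(** The radical is itself a maximal left ideal here; lying in every maximal left ideal, it is the
    only one. *)
Lemma division_quot_local :
  (forall s : S, s <> 0 -> invertible s) -> local_ring R.
Proof.
move=> divS; have J_ideal := jacobson_left_ideal.
have J1 : proper (@jacobson R).
  by move=> /f_ker /eqP; rewrite f1 oner_eq0.
have J_max (K : R -> Prop) : left_ideal K -> proper K ->
    (forall x, jacobson x -> K x) -> forall x, K x -> jacobson x.
  move=> [K0 [KD KM]] K1 sJK x Kx; apply: boolp.contrapT => nJx.
  have /divS [s [_ sfx]] : f x <> 0 by move=> /f_ker.
  have [y yE] := f_surj s; apply: K1; rewrite -(subrK (y * x) 1).
  apply: KD; last exact: KM.
  apply/sJK/f_ker; apply: (addIr (f (y * x))).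
  by rewrite -fD subrK f1 fM yE sfx add0r.
exists (@jacobson R); split; first by [].
move=> N N_max x; split; last exact.
have [N_ideal [N1 _]] := N_max.
by apply: J_max => // y; exact.
Qed.

(** The unique maximal left ideal [M] is the radical. If [f a <> 0], then [M + R a] contains 1,
    which gives [f a] a left inverse. *)
Lemma local_quot_division :
  local_ring R -> forall s : S, s <> 0 -> invertible s.
Proof.
move=> [M [M_max M_unique]].
have MJ x : M x -> jacobson x by move=> Mx N N_max; apply/(M_unique N N_max).
have linv (s : S) : s <> 0 -> exists t, t * s = 1.
  have [a <-] := f_surj s => fa0.
  have [[M0 [MD MM]] [M1 Mmax]] := M_max.
  pose K x := exists m r, M m /\ x = m + r * a.
  have K_ideal : left_ideal K.
    split; first by exists 0, 0; rewrite mul0r addr0.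
    split=> [_ _ [m [r [Mm ->]]] [n [t [Mn ->]]]|t _ [m [r [Mm ->]]]].
      by exists (m + n), (r + t); rewrite mulrDl addrACA; split=> //; exact: MD.
    by exists (t * m), (t * r); rewrite mulrDr mulrA; split=> //; exact: MM.
  have K1 : K 1.
    apply: boolp.contrapT => nK1; apply: fa0; apply/f_ker; apply: MJ.
    apply: (Mmax K) => // [x Mx|].
      by exists x, 0; rewrite mul0r addr0.
    by exists 0, 1; rewrite mul1r add0r.
  have [m [r [/MJ/f_ker fm0 m_r]]] := K1.
  by exists (f r); rewrite -f1 m_r fD fM fm0 add0r.
(* The left inverse [t] has a left inverse too, which must be [s]. *)
move=> s s0; have [t ts] := linv s s0.
have [|u ut] := linv t.
  by move=> t0; move/eqP: ts; rewrite t0 mul0r eq_sym oner_eq0.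
exists t; split=> //.
by have -> : s = u by rewrite -[s]mul1r -ut -mulrA ts mulr1.
Qed.

Lemma iso_quot (T : nzRingType) : iso_rings S T -> quot_J_iso R T.
Proof.
case=> g [gD [gM [g1 [g_inj g_surj]]]].
have gB : forall t t', g t = g t' -> t = t'.
  move=> t t' tt'; apply/eqP; rewrite -subr_eq0; apply/eqP/g_inj.
  by apply: (addIr (g t')); rewrite -gD subrK tt' -{1}[g t']add0r.
have g0 : g 0 = 0 by apply: (addrI (g 0)); rewrite -gD !addr0.
have /boolp.choice [h hK] := g_surj.
exists (h \o f); split=> [x y|] /=; first by apply: gB; rewrite gD !hK fD.
split=> [x y|]; first by apply: gB; rewrite gM !hK fM.
split; first by apply: gB; rewrite hK f1 g1.
split=> [t|x].
  by have [x xE] := f_surj (g t); exists x; apply: gB; rewrite hK.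
rewrite -f_ker; split=> [hx0|fx0]; first by rewrite -(hK (f x)) hx0 g0.
by apply: gB; rewrite hK g0.
Qed.

End LocalQuotient.

(** * The exceptional quotients *)

(** Cayley-Hamilton in size 2. For a matrix of determinant 0 the square is the trace times the
    matrix, so the trace decides the condition. *)
Lemma mx2_sqr (F : comNzRingType) (A : 'M[F]_2) :
  A ^+ 2 = \tr A *: A - (\det A)%:M.
Proof.
have pA : char_poly A = 'X^2 - (\tr A)%:P * 'X + (\det A)%:P.
  apply/polyP=> i; rewrite ![in RHS]coefE.
  case: i => [|[|[|i]]]; rewrite /= ?(subr0, addr0, mulr0, mulr1, sub0r, add0r).
  - by rewrite oppr0 add0r char_poly_det sqrrN expr1n mul1r.
  - exact: (char_poly_trace (n := 2)).
  - have /monicP := char_poly_monic A.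
    by rewrite lead_coefE size_char_poly.
  - by rewrite oppr0 nth_default // size_char_poly.
have := Cayley_Hamilton A; rewrite pA (rmorphD (horner_mx A)) (rmorphB (horner_mx A)).
rewrite (rmorphXn (horner_mx A)) (rmorphM (horner_mx A)) /=.
rewrite !horner_mx_X !horner_mx_C => /eqP; rewrite -addrA addr_eq0 opprD opprK => /eqP ->.
by rewrite -mulmxE mul_scalar_mx.
Qed.

Lemma mx_not_invertible (F : fieldType) n (A : 'M[F]_n.+1) :
  ~ invertible A -> \det A = 0.
Proof.
move=> A_ninv; apply/eqP; apply: boolp.contrapT => /negP dA; apply: A_ninv.
have A_unit : A \in unitmx by rewrite unitmxE unitfE.
by exists (invmx A); rewrite -mulmxE mulmxV ?mulVmx.
Qed.

Lemma Z2_mx_pm_idem : nonunits_pm_idem 'M['Z_2]_2.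
Proof.
(* ['F_2] is ['Z_2] seen as a field. *)
move=> A /(@mx_not_invertible 'F_2) dA; left.
have A2 : A ^+ 2 = \tr A *: A by rewrite mx2_sqr dA raddf0 subr0.
have [trA | trA] := Z2_cases (\tr A); rewrite trA in A2.
- by exists 2; rewrite A2 scale0r sub0r sqrrN A2 scale0r.
- by exists 1%N; rewrite A2 scale1r subrr expr1.
Qed.

Lemma Z3_mx_pm_idem : nonunits_pm_idem 'M['Z_3]_2.
Proof.
move=> A /(@mx_not_invertible 'F_3) dA.
have A2 : A ^+ 2 = \tr A *: A by rewrite mx2_sqr dA raddf0 subr0.
have [trA | trA | trA] := Z3_cases (\tr A); rewrite trA in A2.
- by left; exists 2; rewrite A2 scale0r sub0r sqrrN A2 scale0r.
- by left; exists 1%N; rewrite A2 scale1r subrr expr1.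
- by right; exists 1%N; rewrite A2 scaleN1r addNr expr1.
Qed.

Lemma Z3_square_pm_idem : nonunits_pm_idem ('Z_3 * 'Z_3)%type.
Proof.
move=> [a b] ab_ninv.
have : a = 0 \/ b = 0.
  have [a0 | a0] := Z3_pm a; first by left.
  have [b0 | b0] := Z3_pm b; first by right.
  (* A pair with both squares equal to 1 is its own inverse. *)
  by case: ab_ninv; exists (a, b); split; congr pair.
have sq (x : 'Z_3) : [\/ x * x = x | x * x = - x].
  by case: (Z3_cases x) => ->; [left | left | right];
     rewrite ?mulr0 ?mulr1 ?mulrNN ?opprK ?mulr1.
have nil0 (S : nzRingType) (s : S) : s * s = s \/ s * s = - s -> pm_idem_mod_nil s.
  by case=> ss; [left | right]; exists 1%N; rewrite expr1 expr2 ss ?subrr ?addNr.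
case=> ->; apply: nil0.
  by case: (sq b) => bb; [left | right]; congr pair; rewrite /= ?bb ?mul0r ?oppr0.
by case: (sq a) => aa; [left | right]; congr pair; rewrite /= ?aa ?mul0r ?oppr0.
Qed.

Theorem theorem2p36 (R : unitRingType) (Hsl : semilocal R) :
  GSWNC R <->
  ((local_ring R /\ J_nil R) \/
   (J_nil R /\ quot_J_iso R 'M['Z_3]_2) \/
   (J_nil R /\ quot_J_iso R 'M['Z_2]_2) \/
   (J_nil R /\ quot_J_iso R ('Z_3 * 'Z_3)%type) \/
   swnc_ring R).
Proof.
have [S [[f [fD [fM [f1 [f_surj f_ker]]]]] [_ ssS]]] := Hsl.
split=> [gR|].
  have JR := GSWNC_J_nil fD fM f1 f_ker gR.
  have pmS := GSWNC_quot fD fM f1 f_surj gR.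
  (* A division ring [S] gives the local case; otherwise a nonzero non-unit [a] is available, as the
     reduced case requires. *)
  have [div|] := boolp.EM (forall s : S, s <> 0 -> invertible s).
    by left; split=> //; exact: (division_quot_local fD fM f1 f_surj f_ker div).
  move=> /boolp.existsNP [a /boolp.not_implyP [a0 a_ninv]].
  have iso_R T : iso_rings S T -> quot_J_iso R T.
    exact: (iso_quot fD fM f1 f_surj f_ker).
  have [redS | ] := boolp.EM (reduced S).
    have [swS | nswS] := boolp.EM (forall s : S, pm_idem_mod_nil s).
      by do 4!right; exact: (quot_swnc fD fM f1 f_ker JR swS).
    do 3!right; left; split=> //; apply: iso_R.
    by apply: reduced_Z3_square => //; exists a.
  move=> /boolp.existsNP [x /boolp.not_implyP [xx0 x0]].
  have regS := left_semisimple_regular ssS.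
  have [y xyx] := regS x; have [z xzP] := sq0_pair_ex xx0 xyx.
  have [M2|M3] := sq0_matrix_iso pmS regS xzP x0 erefl.
    by do 2!right; left; split=> //; exact: iso_R.
  by right; left; split=> //; exact: iso_R.
case=> [[locR JR]|[[JR]|[[JR]|[[JR]|swR a _]]]]; last exact: swR.
- apply: (quot_GSWNC fD fM f1 f_surj f_ker JR) => s s_ninv.
  have -> : s = 0.
    apply: boolp.contrapT => s0; apply: s_ninv.
    exact: (local_quot_division fD fM f1 f_surj f_ker locR s0).
  by left; exists 1%N; rewrite expr0n subr0 expr1.
- case=> g [gD [gM [g1 [g_surj g_ker]]]].
  exact: (quot_GSWNC gD gM g1 g_surj g_ker JR Z3_mx_pm_idem).
- case=> g [gD [gM [g1 [g_surj g_ker]]]].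
  exact: (quot_GSWNC gD gM g1 g_surj g_ker JR Z2_mx_pm_idem).
- case=> g [gD [gM [g1 [g_surj g_ker]]]].
  exact: (quot_GSWNC gD gM g1 g_surj g_ker JR Z3_square_pm_idem).
Qed.
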